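(* Let $0\le k\le n$ and $j\ge 1$ be integers. Every hereditary $k$-fold banned $j$-ary sequence problem $f$ of length $n$ has at most $\sum_{i=0}^{k-1}(j-1)^{n-i}\binom{n}{i}$ solutions.
   Context: Write $[n]=\{0,1,\dots,n-1\}$ and let $\binom{[n]}{k}$ denote the collection of subsets of $[n]$ of size $k$. $j$-ary sequences are viewed as functions from a set of indices to $[j]=\{0,\dots,j-1\}$. A $k$-fold banned $j$-ary sequence problem of length $n$ is a function $f:\binom{[n]}{k}\times j^{n-k}\to\mathcal{P}(j^k)\setminus\{\emptyset\}$. Precisely: for each $S\in\binom{[n]}{k}$ and each function $X:[n]\setminus S\to[j]$, $f(S,X)$ is a nonempty set of functions $Z:S\to[j]$. For sequences $X,Y$ with disjoint domains, $X\wedge Y$ denotes their union (as functions). A solution to $f$ is a function $X:[n]\to[j]$ such that for every $S\in\binom{[n]}{k}$, $X|_S\notin f(S,X|_{[n]\setminus S})$. $f$ is not hereditary if there are $S\in\binom{[n]}{k}$ and a choice, for each function $Z_\alpha:S\to[j]$, of a function $X_\alpha:[n]\setminus S\to[j]$ such that $Z_\alpha\notin f(S,X_\alpha)$ for every $\alpha$ and, whenever $Z_\alpha\ne Z_\beta$, the first (smallest) index at which $X_\alpha\wedge Z_\alpha$ and $X_\beta\wedge Z_\beta$ differ belongs to $S$. Otherwise $f$ is hereditary. *)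

(* Defs.v *)
From mathcomp Require Import all_boot.

Set Implicit Arguments.
Unset Strict Implicit.
Unset Printing Implicit Defensive.

Definition jseq (n j : nat) := {ffun 'I_n -> 'I_j}.

Definition ksubset (n k : nat) := {S : {set 'I_n} | #|S| == k}.

(* Partial sequences with domain S (inseq) or [n] \ S (outseq): functions on
   the finite subtype of indices in, resp. outside, S. *)
Definition inseq (n j : nat) (S : {set 'I_n}) :=
  {ffun {i : 'I_n | i \in S} -> 'I_j}.
Definition outseq (n j : nat) (S : {set 'I_n}) :=
  {ffun {i : 'I_n | i \notin S} -> 'I_j}.

Definition res_in (n j : nat) (S : {set 'I_n}) (X : jseq n j) : inseq j S :=
  [ffun i => X (val i)].
Definition res_out (n j : nat) (S : {set 'I_n}) (X : jseq n j) : outseq j S :=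
  [ffun i => X (val i)].

(* X /\ Z, for the complementary domains [n] \ S and S. *)
Definition union_seq (n j : nat) (S : {set 'I_n})
    (X : outseq j S) (Z : inseq j S) : jseq n j :=
  [ffun i => match boolP (i \in S) with
             | AltTrue iS => Z (exist _ i iS)
             | AltFalse iNS => X (exist _ i iNS)
             end].

Record banned_problem (n k j : nat) := BannedProblem {
  banned :> forall S : ksubset n k, outseq j (val S) -> {set inseq j (val S)};
  banned_neq0 : forall (S : ksubset n k) (X : outseq j (val S)),
    banned X != set0
}.

Definition solutions (n k j : nat) (f : banned_problem n k j) :
    {set jseq n j} :=
  [set X | [forall S : ksubset n k,
              res_in (val S) X \notin f S (res_out (val S) X)]].

(* The smallest index at which V and W differ exists and lies in S. *)
Definition first_diff_in (n j : nat) (S : {set 'I_n}) (V W : jseq n j) : Prop :=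
  exists i : 'I_n,
    [/\ V i <> W i, (forall l : 'I_n, l < i -> V l = W l) & i \in S].

Definition not_hereditary (n k j : nat) (f : banned_problem n k j) : Prop :=
  exists (S : ksubset n k) (X : inseq j (val S) -> outseq j (val S)),
    (forall Z, Z \notin f S (X Z)) /\
    (forall Z Z', Z <> Z' ->
       first_diff_in (val S) (union_seq (X Z) Z) (union_seq (X Z') Z')).

Definition hereditary (n k j : nat) (f : banned_problem n k j) : Prop :=
  ~ not_hereditary f.

(* Main.v *)
Require Import Defs.
From mathcomp Require Import all_boot.

(** The theorem is a Sauer-Shelah bound for order-shattering.  Call a set [S] of
    indices order-shattered by a family [A] of sequences when [A] contains the
    leaves of a tree that branches into all [j] letters at each level in [S]
    and follows a single letter, possibly depending on the node, at each other
    level.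

    If the solutions order-shatter a set with at least [k] elements, keep only
    [k] of its levels as free branchings and fix a letter at the others: every
    [Z] on the chosen [k]-set [S] extends to a solution, and two such solutions
    first differ at a level of [S].  A solution avoids [f S], so these
    extensions witness that [f] is not hereditary
    ([order_shattering_not_hereditary]).

    It remains to see that a family of size more than the stated bound
    order-shatters a set of size at least [k].  This follows from the weighted
    inequality ([card_le_order_shattered])
      [#|A| <= \sum_(S order-shattered by A) (j - 1) ^ (n - #|S|)],
    proved by induction on [n] by splitting [A] according to the first letter.
    If [S'] is order-shattered by [p] of the [j] subfamilies, its weight is
    counted [p] times on the left.  When [0 < p < j], the set [S'] alone is
    order-shattered by [A], with weight [j - 1 >= p] times as large; when
    [p = j], adding the first index to [S'] gives a second order-shattered set,
    which pays for the missing unit. *)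

Set Implicit Arguments.
Unset Strict Implicit.
Unset Printing Implicit Defensive.

(** * Order-shattering *)

Section OrderShattering.

Variables (T : finType) (x0 : T).
Implicit Types (A : pred (seq T)) (m : seq bool) (g : nat -> T).

(** The mask [m] marks the levels of the set; the recursion reads the tree from
    its root. *)
Fixpoint order_shatters A m : bool :=
  match m with
  | [::] => A [::]
  | b :: m' =>
      let P a := order_shatters (fun s => A (a :: s)) m' in
      if b then [forall a, P a] else [exists a, P a]
  end.

(** The leaf reached when the branchings are resolved by [g] and the other
    levels by the tree. *)
Fixpoint branch A m g : seq T :=
  match m with
  | [::] => [::]
  | b :: m' =>
      let a := if b then g 0 else
        odflt x0 [pick a | order_shatters (fun s => A (a :: s)) m'] in
      a :: branch (fun s => A (a :: s)) m' (fun i => g i.+1)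
  end.

Lemma branch_in A m g : order_shatters A m -> A (branch A m g).
Proof.
elim: m A g => [|[] m IHm] A g //=.
  by move/forallP/(_ (g 0)) => /IHm; apply.
case: pickP => [a Pa _|P0 /existsP[a]]; last by rewrite P0.
exact: (IHm (fun s => A (a :: s))).
Qed.

Lemma nth_branch A m g i : nth false m i -> nth x0 (branch A m g) i = g i.
Proof.
elim: m A g i => [|b m IHm] A g [|i] //=; first by case: b.
exact: IHm.
Qed.

(** A tree does not look ahead: the letters of a branch up to level [i] depend
    only on the choices made at marked levels up to [i]. *)
Lemma branch_nonanticipating A m g g' i :
    (forall l, l <= i -> nth false m l -> g l = g' l) ->
  nth x0 (branch A m g) i = nth x0 (branch A m g') i.
Proof.
elim: m A g g' i => [|b m IHm] A g g' i //= eq_g.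
have -> : (if b then g 0 else
        odflt x0 [pick a | order_shatters (fun s => A (a :: s)) m])
    = (if b then g' 0 else
        odflt x0 [pick a | order_shatters (fun s => A (a :: s)) m]).
  by case: b eq_g => // eq_g; apply: (eq_g 0).
case: i eq_g => [|i] eq_g //=.
by apply: IHm => l le_li m_l; apply: (eq_g l.+1).
Qed.

(** * The weighted counting inequality *)

Lemma sum_tuple_cons (U : finType) n (F : seq U -> nat) :
  \sum_(t : n.+1.-tuple U) F t = \sum_(a : U) \sum_(t : n.-tuple U) F (a :: t).
Proof.
rewrite pair_big /=
  (reindex (fun p : U * n.-tuple U => [tuple of p.1 :: p.2])) //.
exists (fun t : n.+1.-tuple U => (thead t, [tuple of behead t])).
  by move=> [a t] _ /=; congr (_, _); apply: val_inj.
by move=> t _; rewrite /= -tuple_eta.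
Qed.

(** The exchange rate of the induction: [P a] will say that a fixed tail mask is
    shattered after the letter [a]; the two terms on the right are then the
    masks extending it with a marked, resp. unmarked, first level. *)
Lemma sum_letters_le (P : pred T) :
  \sum_(a : T) P a <= [forall a, P a] + [exists a, P a] * (#|T| - 1).
Proof.
have -> : \sum_(a : T) P a = #|P|.
  rewrite -sum1_card [RHS]big_mkcond; apply: eq_bigr => a _.
  by rewrite unfold_in; case: (P a).
have [/forallP allP|/forallPn [a Pa]] := boolP [forall a, P a].
  have -> : [exists a, P a] by apply/existsP; exists x0.
  by rewrite mul1n -leq_subLR leq_sub2r ?max_card.
have [_|/existsPn noP] := boolP [exists a, P a].
  rewrite mul1n add0n subn1 -ltnS prednK; last by apply/card_gt0P; exists a.
  apply: proper_card; apply/properP; split; first exact/subsetP.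
  by exists a.
by rewrite leqn0; apply/eqP/eq_card0 => b; apply/negbTE/noP.
Qed.

(** [#|T| - 1] bounds the number of letters after which a tail can be shattered
    without being shattered after all of them, so each unmarked level
    contributes this factor to the weight of a mask. *)
Lemma card_le_order_shattered n A :
  \sum_(t : n.-tuple T) A t <=
  \sum_(m : n.-tuple bool) order_shatters A m * (#|T| - 1) ^ count negb m.
Proof.
elim: n A => [|n IHn] A.
  have sum0 (U : finType) (F : seq U -> nat) :
    \sum_(t : 0.-tuple U) F t = F [::].
    by rewrite (big_pred1 [tuple]) // => t; rewrite [t]tuple0; apply/esym/eqP.
  rewrite (sum0 T A).
  rewrite (sum0 _ (fun m => order_shatters A m * (#|T| - 1) ^ count negb m)).
  by rewrite muln1.
rewrite (sum_tuple_cons n A).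
rewrite (sum_tuple_cons n
  (fun m => order_shatters A m * (#|T| - 1) ^ count negb m)).
rewrite big_bool -big_split /=.
apply: (@leq_trans (\sum_(a : T) \sum_(m : n.-tuple bool)
    order_shatters (fun s => A (a :: s)) m * (#|T| - 1) ^ count negb m)).
  by apply: leq_sum => a _; apply: IHn.
rewrite exchange_big /=; apply: leq_sum => m _.
rewrite -big_distrl /= add0n add1n expnS mulnA -mulnDl leq_mul2r.
by rewrite sum_letters_le orbT.
Qed.

End OrderShattering.

(** * Counting masks *)

Lemma count_tuple_set n (m : n.-tuple bool) :
  count id m = #|[set i | tnth m i]|.
Proof.
by rewrite cardsE -sum1_card -sum1_count big_tuple.
Qed.

Lemma sum_small_masks n k c :
  \sum_(m : n.-tuple bool | count id m < k) c ^ count negb m =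
  \sum_(0 <= i < k) c ^ (n - i) * 'C(n, i).
Proof.
rewrite (reindex (fun S : {set 'I_n} => [tuple i \in S | i < n])) /=; last first.
  exists (fun m : n.-tuple bool => [set i | tnth m i]) => [S _|m _].
    by apply/setP => i; rewrite inE tnth_mktuple.
  by apply: eq_from_tnth => i; rewrite tnth_mktuple inE.
have cnt (S : {set 'I_n}) : count id [tuple i \in S | i < n] = #|S|.
  by rewrite count_tuple_set; apply: eq_card => i; rewrite inE tnth_mktuple.
have cntN (S : {set 'I_n}) : count negb [tuple i \in S | i < n] = n - #|S|.
  have := count_predC id [tuple i \in S | i < n].
  by rewrite cnt size_tuple => /(congr1 (subn^~ #|S|)) /=; rewrite addKn.
transitivity (\sum_(S : {set 'I_n} | #|S| < k) c ^ (n - #|S|)).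
  by apply: eq_big => S; rewrite ?cnt ?cntN.
rewrite big_mkord.
case: k => [|k]; first by rewrite big_ord0 big_pred0.
rewrite (partition_big (fun S : {set 'I_n} => inord #|S| : 'I_k.+1) predT) //=.
apply: eq_bigr => i _.
rewrite (eq_bigl (fun S : {set 'I_n} => #|S| == i)); last first.
  move=> S; apply/andP/eqP => [[lt_Sk /eqP <-]|eqS]; first by rewrite inordK.
  by rewrite eqS ltn_ord inord_val.
rewrite (eq_bigr (fun=> c ^ (n - i))) => [|S /eqP->//].
by rewrite sum_nat_const mulnC -[n in 'C(n, _)]card_ord -card_draws cardsE.
Qed.

(** * From shattering to failure of heredity *)

Lemma union_seq_res n j (S : {set 'I_n}) (X : jseq n j) :
  union_seq (res_out S X) (res_in S X) = X.
Proof.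
by apply/ffunP => i; rewrite ffunE; case: {-}_ / boolP => iS; rewrite ffunE.
Qed.

Lemma first_diff n j (V W : jseq n j) :
    V <> W ->
  exists2 i : 'I_n, V i <> W i & forall l : 'I_n, l < i -> V l = W l.
Proof.
move=> neqVW.
have [i0 di0] : exists i, V i != W i.
  apply/existsP; apply: contra_notT neqVW => /existsPn eqVW.
  by apply/ffunP => i; apply/eqP; move: (eqVW i); rewrite negbK.
case: (@arg_minnP _ i0 (fun i => V i != W i) val di0) => i /eqP di mini.
exists i => // l lt_li; apply/eqP; apply: contraTT lt_li => dl.
by rewrite -leqNgt mini.
Qed.

Section Heredity.

Variables (n k j : nat) (f : banned_problem n k j).

Definition solution_seqs : pred (seq 'I_j) :=
  [pred s | [exists X in solutions f, tval [tuple X i | i < n] == s]].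

Lemma card_solution_seqs :
  #|solutions f| = \sum_(t : n.-tuple 'I_j) solution_seqs t.
Proof.
pose F (X : jseq n j) := [tuple X i | i < n].
have injF : injective F.
  move=> X Y eqXY; apply/ffunP => i.
  by move: (congr1 (fun t => tnth t i) eqXY); rewrite !tnth_mktuple.
rewrite -(card_imset _ injF) -sum1_card big_mkcond /=.
apply: eq_bigr => t _.
suff -> : (t \in F @: solutions f) = solution_seqs t by case: solution_seqs.
apply/imsetP/exists_inP => [[X sX ->]|[X sX /eqP eqX]]; exists X => //.
exact: val_inj.
Qed.

Lemma order_shattering_not_hereditary (x0 : 'I_j) (m : n.-tuple bool) :
    order_shatters solution_seqs m -> k <= count id m -> not_hereditary f.
Proof.
move=> shm; rewrite count_tuple_set => /card_geqP/= [s [uniq_s size_s sub_s]].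
have cardS : #|[set i in s]| == k by rewrite cardsE (card_uniqP uniq_s) size_s.
pose S : ksubset n k := Sub [set i in s] cardS.
have m_in (l : 'I_n) : l \in val S -> nth false m l.
  by rewrite /= inE => /sub_s; rewrite inE (tnth_nth false).
(* A fixed letter at the marked levels outside S prevents two branches from
   separating there. *)
pose g (Z : inseq j (val S)) i : 'I_j :=
  if insub i is Some l then
    if insub l is Some l' then Z l' else x0
  else x0.
have g_in Z (l : {i | i \in val S}) : g Z (val (val l)) = Z l.
  by rewrite /g !valK.
have g_out Z (l : 'I_n) : l \notin val S -> g Z l = x0.
  by move=> lS; rewrite /g valK insubN.
pose W Z : jseq n j :=
  [ffun i : 'I_n => nth x0 (branch x0 solution_seqs m (g Z)) i].
have W_sol Z : W Z \in solutions f.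
  have /exists_inP[X sX /eqP eqX] := branch_in x0 (g Z) shm.
  suff -> : W Z = X by [].
  by apply/ffunP => i; rewrite ffunE -eqX -tnth_nth tnth_mktuple.
have res_W Z : res_in (val S) (W Z) = Z.
  apply/ffunP => l; rewrite !ffunE nth_branch ?g_in //.
  exact/m_in/(valP l).
exists S, (fun Z => res_out (val S) (W Z)); split=> [Z|Z Z' neqZ].
  by move: (W_sol Z); rewrite inE => /forallP/(_ S); rewrite res_W.
rewrite -{2}(res_W Z) -{2}(res_W Z') !union_seq_res.
have [|i di mini] := @first_diff _ _ (W Z) (W Z').
  by move=> eqW; apply: neqZ; rewrite -(res_W Z) eqW res_W.
exists i; split=> //; apply/negPn/negP => iS; apply: di; rewrite !ffunE.
apply: branch_nonanticipating => l le_li _.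
pose l' : 'I_n := Ordinal (leq_ltn_trans le_li (ltn_ord i)).
have [lS|lS] := boolP (l' \in val S); last by rewrite -[l]/(val l') !g_out.
(* A choice made at a level of S is read off the branch itself, and the two
   branches agree strictly below i. *)
have lt_li : l' < i.
  rewrite ltn_neqAle le_li andbT; apply: contraNneq iS => eq_li.
  by rewrite -(val_inj eq_li).
by have := mini l' lt_li; rewrite !ffunE !nth_branch ?m_in.
Qed.

End Heredity.

Theorem theorem5p3 (n k j : nat) (hkn : k <= n) (hj : 1 <= j)
    (f : banned_problem n k j) (hf : hereditary f) :
  #|solutions f| <= \sum_(0 <= i < k) (j - 1) ^ (n - i) * 'C(n, i).
Proof.
pose x0 : 'I_j := Ordinal hj.
rewrite card_solution_seqs -sum_small_masks.
apply: leq_trans (card_le_order_shattered x0 n (solution_seqs f)) _.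
rewrite card_ord [leqRHS]big_mkcond /=; apply: leq_sum => m _.
have [shm|] := boolP (order_shatters _ m); last by [].
case: ltnP => [_|le_km]; first by rewrite mul1n.
by case: hf; apply: order_shattering_not_hereditary x0 m shm le_km.
Qed.
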